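(* Let $R_1$ and $R_2$ be reduced words in the alphabet $\{1,\dots,n-1\}$. Suppose that for some $i$ with $1\le i\le n-2$, some word $Q$ of length $0$ or $1$, and some word $R$, one has \[R_1=Q\,i\,(i+1)\,i\,R,\qquad R_2=Q\,(i+1)\,i\,(i+1)\,R.\] Then $\mathbb P_{R_1,q}\ne \mathbb P_{R_2,q}$ (as functions of $q$, i.e. there is $w\in S_n$ with $\mathbb P_{R_1,q}(w)\neq \mathbb P_{R_2,q}(w)$ as rational functions of $q$).
   Context: $S_n$ has simple transpositions $s_i=(i\ i+1)$ and Coxeter length $\ell$. A word $R=i_1\cdots i_L$ ($i_j\in\{1,\dots,n-1\}$) is reduced if $\ell(s_{i_1}\cdots s_{i_L})=L$; juxtaposition denotes concatenation of words. For a prime power $q$, let $G=\mathrm{GL}_n(\mathbb F_q)$, $B$ the upper triangular invertible matrices, $E_\bullet$ the standard flag, $X_w^\circ=B\cdot E^w_\bullet$ where $E^w_i=\langle e_{w(1)},\dots,e_{w(i)}\rangle$. The Bott--Samelson variety of $R=i_1\cdots i_L$ consists of sequences of complete flags $(F^{(0)}_\bullet,\dots,F^{(L)}_\bullet)$ with $F^{(0)}_\bullet=E_\bullet$ and $F^{(r-1)}_k=F^{(r)}_k$ for $k\ne i_r$; $\pi_R$ maps it to $F^{(L)}_\bullet$. Set $\mathbb P_{R,q}(w)=|\pi_R^{-1}(X_w^\circ)|/(q+1)^{L}$, which for each $w$ is a rational function of $q$. *)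

(* Defs.v *)
From HB Require Import structures.
From mathcomp Require Import all_boot all_order all_algebra all_fingroup.

Set Implicit Arguments.
Unset Strict Implicit.
Unset Printing Implicit Defensive.

Import GRing.Theory.
Local Open Scope ring_scope.

(* Letters are numbered from 1, ordinals from 0: the letter i exchanges the
   ordinals of value i - 1 and i. Out-of-range letters give the identity. *)
Definition simple_transp (n i : nat) : 'S_n :=
  match insub i.-1, insub i with
  | Some a, Some b => tperm a b
  | _, _ => 1%g
  end.

Definition is_word (n : nat) (R : seq nat) : bool :=
  all (fun i => 0 < i < n)%N R.

(* MathComp multiplies permutations from left to right; composing the other way
   gives the inverse permutation, which has the same Coxeter length. *)
Definition word_perm (n : nat) (R : seq nat) : 'S_n :=
  (\prod_(i <- R) simple_transp n i)%g.

Definition has_expression (n : nat) (w : 'S_n) (k : nat) : bool :=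
  [exists t : k.-tuple 'I_n,
     is_word n (map val t) && (word_perm n (map val t) == w)].

Lemma has_expressionP (n : nat) (w : 'S_n) (k : nat) :
  reflect (exists R, [/\ is_word n R, word_perm n R = w & size R = k])
          (has_expression w k).
Proof.
apply: (iffP existsP) => [[t /andP[wt /eqP tw]]|[R [wR Rw sR]]].
  by exists (map val t); rewrite size_map size_tuple.
have ltR : all (fun i => i < n)%N R by apply: sub_all wR => i /andP[].
have eqR : map val (pmap (insub : nat -> option 'I_n) R) = R.
  by rewrite -[RHS](all_filterP (s := R) ltR) (pmap_filter (insubK _)) //;
     apply: eq_filter => i; rewrite isSome_insub.
have sz : size (pmap (insub : nat -> option 'I_n) R) == k.
  by rewrite -sR -[in X in _ == X]eqR size_map.
by exists (Tuple sz); rewrite /= eqR wR Rw eqxx.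
Qed.

Lemma tperm_expression (n d : nat) (a b : 'I_n) :
  (a + d.+1 = b)%N -> exists2 R, is_word n R & word_perm n R = tperm a b.
Proof.
elim: d b => [|d IHd] b ab.
  exists [:: val b]; first by rewrite /is_word /= ltn_ord -ab addn1.
  have -> : word_perm n [:: val b] = simple_transp n b.
    by rewrite /word_perm big_seq1.
  rewrite /simple_transp valK.
  by have -> : (val b).-1 = val a; [rewrite /= -ab addn1 | rewrite valK].
have lt_c : (a + d.+1 < n)%N.
  by apply: leq_ltn_trans (ltn_ord b); rewrite -ab leq_add2l.
have [R wR Rac] := IHd (Ordinal lt_c) erefl.
set c := Ordinal lt_c in Rac.
exists (val b :: rcons R (val b)).
  rewrite /is_word /= all_rcons -/(is_word n R) wR andbT andbb ltn_ord andbT.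
  by rewrite -ab addnS.
have sb : simple_transp n b = tperm c b.
  rewrite /simple_transp valK.
  by have -> : (val b).-1 = val c; [rewrite /= -ab addnS | rewrite valK].
rewrite /word_perm big_cons big_rcons /= -/(word_perm n R) Rac sb.
have lt_ab : (a < b)%N by rewrite -ab addnS ltnS leq_addr.
have lt_ac : (a < c)%N by rewrite /= addnS ltnS leq_addr.
by rewrite -{1}(tpermV c b) -/(conjg _ _) tpermJ tpermL tpermD // -val_eqE /= neq_ltn
  ?lt_ab ?lt_ac orbT.
Qed.

Lemma expression_exists (n : nat) (w : 'S_n) : exists k, has_expression w k.
Proof.
suff [R wR Rw] : exists2 R, is_word n R & word_perm n R = w.
  by exists (size R); apply/has_expressionP; exists R.
have [ts -> _] := prod_tpermP w.
elim: ts => [|[a b] ts [R wR Rw]]; first by exists [::] => //; rewrite /word_perm !big_nil.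
suff [S wS Sab] : exists2 S, is_word n S & word_perm n S = tperm a b.
  exists (S ++ R); first by rewrite /is_word all_cat; apply/andP.
  by rewrite big_cons /word_perm big_cat /= -/(word_perm n S) Sab -Rw.
case: (ltngtP a b) => [ab|ba|/val_inj ->].
- by apply: (@tperm_expression _ (b - a.+1)); rewrite addnS -addSn subnKC.
- by rewrite tpermC;
  apply: (@tperm_expression _ (a - b.+1)); rewrite addnS -addSn subnKC.
by exists [::] => //; rewrite /word_perm big_nil tperm1.
Qed.

Definition coxeter_length (n : nat) (w : 'S_n) : nat :=
  ex_minn (expression_exists w).

Definition reduced (n : nat) (R : seq nat) : bool :=
  is_word n R && (coxeter_length (word_perm n R) == size R).

Section FiniteSubspaces.

(* The subtype structure of {vspace vT} lives in this internal module. *)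
Import VectorInternalTheory.

Variables (F : finFieldType) (vT : vectType F).

HB.instance Definition _ := [Countable of {vspace vT} by <:].
HB.instance Definition _ := [Finite of {vspace vT} by <:].

End FiniteSubspaces.

Section Flags.

Variables (F : finFieldType) (n : nat).

(* A complete flag is recorded with its trivial terms of index 0 and n. *)
Definition subspace_seq := {ffun 'I_n.+1 -> {vspace 'cV[F]_n}}.

Definition is_flag (f : subspace_seq) : bool :=
  [forall k, \dim (f k) == k :> nat] &&
  [forall j : 'I_n.+1, forall k : 'I_n.+1, (j <= k)%N ==> (f j <= f k)%VS].

Definition coord_flag (w : 'S_n) : subspace_seq :=
  [ffun k : 'I_n.+1 =>
     (\sum_(j < n | (j < k)%N) <[delta_mx (w j) ord0 : 'cV[F]_n]>)%VS].

Definition std_flag : subspace_seq := coord_flag 1%g.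

Definition borel : {set 'M[F]_n} :=
  [set g | (g \in unitmx) &&
     [forall i : 'I_n, forall j : 'I_n, (j < i)%N ==> (g i j == 0)]].

Definition flag_act (g : 'M[F]_n) (f : subspace_seq) : subspace_seq :=
  [ffun k => (linfun (mulmx g) @: f k)%VS].

Definition schubert_cell (w : 'S_n) : {set subspace_seq} :=
  [set flag_act g (coord_flag w) | g in borel].

(* The step r : 'I_L goes from the flag numbered r to the flag numbered r + 1
   and uses the letter number r + 1 of the word, which is nth 0 R r. *)
Definition bott_samelson (R : seq nat) :
    {set {ffun 'I_(size R).+1 -> subspace_seq}} :=
  [set Fs : {ffun 'I_(size R).+1 -> subspace_seq} |
    [&& [forall r, is_flag (Fs r)],
        Fs ord0 == std_flag &
        [forall r : 'I_(size R), forall k : 'I_n.+1,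
           (k != nth 0%N R r :> nat) ==>
           (Fs (widen_ord (leqnSn _) r) k == Fs (lift ord0 r) k)]]].

Definition bs_proj (R : seq nat) (Fs : {ffun 'I_(size R).+1 -> subspace_seq}) :
  subspace_seq := Fs ord_max.

Definition bs_prob (R : seq nat) (w : 'S_n) : rat :=
  #|[set Fs in bott_samelson R | bs_proj Fs \in schubert_cell w]|%:R
  / (#|F|%:R + 1) ^+ size R.

End Flags.

(* f is the rational function of q whose value at every prime power q is the
   Bott--Samelson probability over the field with q elements; it is unique since
   there are infinitely many prime powers. *)
Definition is_bs_prob_ratfun (n : nat) (R : seq nat) (w : 'S_n)
    (f : {fraction {poly rat}}) : Prop :=
  exists num den : {poly rat},
    f = FracField.tofrac num / FracField.tofrac den /\
    forall F : finFieldType,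
      den.[#|F|%:R] != 0 /\
      bs_prob F R w = num.[#|F|%:R] / den.[#|F|%:R].

(* Main.v *)
(* Writing c_R(w) for the number of galleries of type R from the standard flag to
   the coordinate flag of w, prepending a letter to R acts on the function c_R as
   left multiplication by 1 + T_i in the Iwahori-Hecke algebra, so the c_R(w) are
   polynomials in q. The cell of w carries |X_w| c_R(w) galleries, and |X_w| is a
   power of q. Moreover
     (1+T_i)(1+T_j)(1+T_i) - (1+T_j)(1+T_i)(1+T_j) = q (T_i - T_j)   (j = i + 1),
   so it suffices that (1+T_k)(T_i - T_j) c_R does not vanish, where k is the letter
   of Q, and this is seen at the permutation u of the word iR. Permutations longer
   than a word have coefficient 0 in its product, those of the same length have
   coefficient 1 or 0, and for a reduced word those shorter by one have a constant
   coefficient. Hence the coefficient at u is 1 if s_k u > u, and q plus a constant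
   if s_k u < u. Permutations are indexed through their inverses, since MathComp
   composes from left to right. *)
Require Import Defs.
From HB Require Import structures.
From mathcomp Require Import all_boot all_order all_algebra all_fingroup.
From mathcomp Require Import ring zify.

Set Implicit Arguments.
Unset Strict Implicit.
Unset Printing Implicit Defensive.

Import GRing.Theory.
Local Open Scope ring_scope.

(** * Inversion numbers and Coxeter length *)

Section Inversions.

Variable n : nat.
Implicit Types (u v : 'S_n) (a b : 'I_n).

Definition inversions u : {set 'I_n * 'I_n} :=
  [set p : 'I_n * 'I_n | (p.1 < p.2)%N && (u p.2 < u p.1)%N].

Definition ninv u : nat := #|inversions u|.

Lemma simple_transpE i : (0 < i < n)%N ->
  exists a b, [/\ i = a.+1, b = a.+1 :> nat & simple_transp n i = tperm a b].
Proof.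
case/andP=> i_gt0 lt_in; have lt_an : (i.-1 < n)%N by rewrite prednK // ltnW.
exists (Ordinal lt_an), (Ordinal lt_in); rewrite /= prednK //; split=> //.
by rewrite /simple_transp !insubT.
Qed.

(** No ordinal lies strictly between two consecutive ones, so exchanging them reverses that pair
    only. *)
Lemma ltn_tperm a b (x y : 'I_n) : b = a.+1 :> nat -> (x < y)%N -> (x, y) != (a, b) ->
  (tperm a b x < tperm a b y)%N.
Proof.
rewrite xpair_eqE -!val_eqE /= => eb lt_xy /negP nab.
by case: tpermP => [ex|ex|/eqP + /eqP]; case: tpermP => [ey|ey|/eqP + /eqP];
   rewrite -?val_eqE /=; subst; lia.
Qed.

(** Applying the transposition to both coordinates embeds the inversions of [u] in those of the
    product; the pair [(a, b)] is the only new one. *)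
Lemma ninv_tperm_up u a b : b = a.+1 :> nat -> (u a < u b)%N ->
  ninv (tperm a b * u)%g = (ninv u).+1.
Proof.
move=> eb lt_u; set s := tperm a b.
pose sp (p : 'I_n * 'I_n) := (s p.1, s p.2).
have spK : involutive sp by case=> x y; rewrite /sp /= !tpermK.
have -> : (ninv u).+1 = #|(a, b) |: sp @: inversions u|.
  rewrite cardsU1 card_imset; last exact: inv_inj.
  suff -> : (a, b) \notin sp @: inversions u by [].
  apply/imsetP=> -[[x y] /[!inE] /andP[/= lt_xy _] [ex ey]].
  have [ex' ey'] : x = b /\ y = a.
    by rewrite -[x](tpermK a b) -[y](tpermK a b) -/s -ex -ey tpermL tpermR.
  by move: lt_xy; rewrite ex' ey' eb; lia.
apply: eq_card => -[x y]; rewrite !inE /= !permM -/s.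
have [/eqP[-> ->]|nab] /= := boolP (_ == _).
  by rewrite /s tpermL tpermR lt_u eb ltnSn.
rewrite -[(x, y)]spK mem_imset; last exact: inv_inj.
rewrite !inE /=; apply: andb_id2r => lt_us.
apply/idP/idP => [/ltn_tperm|lt_s]; first exact.
rewrite -[x](tpermK a b) -[y](tpermK a b); apply: ltn_tperm => //.
apply/negP => /eqP[ex ey].
by move: lt_us; rewrite /s ex ey; lia.
Qed.

Lemma ninv_tperm_down u a b : b = a.+1 :> nat -> (u b < u a)%N ->
  ninv u = (ninv (tperm a b * u)%g).+1.
Proof.
move=> eb lt_u; rewrite -(@ninv_tperm_up _ a b) //.
  by rewrite mulgA tperm2 mul1g.
by rewrite !permM tpermL tpermR.
Qed.

Lemma ltn_ninv_tperm u a b : b = a.+1 :> nat ->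
  (ninv u < ninv (tperm a b * u)%g)%N = (u a < u b)%N.
Proof.
move=> eb; case: (ltngtP (u a) (u b)) => [lt_u|lt_u|/val_inj/perm_inj eab].
- by rewrite ninv_tperm_up ?ltnSn.
- by rewrite [ninv u](ninv_tperm_down eb lt_u); lia.
- by move: eb; rewrite eab; lia.
Qed.

Lemma ninv_simple_transp u i : (0 < i < n)%N ->
  ninv (simple_transp n i * u)%g = (ninv u).+1 \/
  ninv u = (ninv (simple_transp n i * u)%g).+1.
Proof.
move=> /simple_transpE[a [b [_ eb ->]]] /=.
case: (ltngtP (u a) (u b)) => [lt_u|lt_u|/val_inj/perm_inj eab].
- by left; rewrite ninv_tperm_up.
- by right; rewrite -ninv_tperm_down.
- by move: eb; rewrite eab; lia.
Qed.

Lemma simple_transpK i u :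
  (simple_transp n i * (simple_transp n i * u))%g = u.
Proof.
rewrite mulgA /simple_transp.
by do 2?case: insub => [?|]; rewrite ?tperm2 ?mulg1 ?mul1g.
Qed.

Lemma ninv1 : ninv 1%g = 0%N.
Proof. by apply: eq_card0 => -[x y]; rewrite !inE !perm1 /=; lia. Qed.

Lemma word_perm_cons i R :
  word_perm n (i :: R) = (simple_transp n i * word_perm n R)%g.
Proof. by rewrite /word_perm big_cons. Qed.

Lemma ninv_word_perm R : is_word n R -> (ninv (word_perm n R) <= size R)%N.
Proof.
elim: R => [|i R IH] /=; first by rewrite /word_perm big_nil ninv1.
case/andP=> /(ninv_simple_transp (word_perm n R)) + /IH.
by rewrite word_perm_cons; lia.
Qed.

(** Strict growth gives [a <= u a] by induction from the bottom and [u a <= a] by induction from the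
    top. *)
Lemma ascending_perm u :
  (forall a b, b = a.+1 :> nat -> (u a < u b)%N) -> u = 1%g.
Proof.
move=> u_asc.
have u_mono d a b : b = (a + d.+1)%N :> nat -> (u a < u b)%N.
  elim: d b => [|d IH] b eb; first by apply: u_asc; rewrite eb addn1.
  have lt_cn : (a + d.+1 < n)%N by have := ltn_ord b; lia.
  apply: leq_trans (IH (Ordinal lt_cn) erefl) _; apply/ltnW/u_asc.
  by rewrite eb /= addnS.
have le_u m (a : 'I_n) : (a = m :> nat)%N -> (a <= u a)%N.
  elim: m a => [|m IH] a ea; first by rewrite ea.
  have lt_mn : (m < n)%N by have := ltn_ord a; lia.
  have := IH (Ordinal lt_mn) erefl.
  have := u_asc (Ordinal lt_mn) a ea; rewrite /= ea; lia.
have ge_u m (a : 'I_n) : (a + m.+1 = n)%N -> (u a <= a)%N.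
  elim: m a => [|m IH] a ea; first by have := ltn_ord (u a); lia.
  have lt_an : (a.+1 < n)%N by lia.
  have := IH (Ordinal lt_an) _; rewrite /=.
  have := u_asc a (Ordinal lt_an) erefl; lia.
apply/permP=> a; rewrite perm1; apply/val_inj/eqP; rewrite eqn_leq /=.
rewrite (le_u _ _ erefl) andbT; apply: (@ge_u (n - a.+1)%N).
by have := ltn_ord a; lia.
Qed.

(** Bubble sort: a permutation with inversions has a descent at adjacent positions, and undoing it
    lowers the inversion number by one. *)
Lemma ninv_expression u : has_expression u (ninv u).
Proof.
move: {2}(ninv u) (erefl (ninv u)) => m; elim: m u => [|m IH] u eu.
  apply/has_expressionP; exists [::]; split; rewrite ?eu //.
  rewrite /word_perm big_nil; apply/esym/ascending_perm => a b eb.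
  rewrite ltnNge leq_eqVlt negb_or.
  have -> : ~~ (u b < u a)%N.
    by apply/negP => /(ninv_tperm_down eb); rewrite eu.
  by rewrite andbT val_eqE (inj_eq perm_inj) -val_eqE /=; lia.
have [a [b [eb lt_u]]] : exists a b, b = a.+1 :> nat /\ (u b < u a)%N.
  have [/existsP[a /existsP[b /andP[/eqP ? ?]]]|nex] :=
    boolP [exists a : 'I_n, exists b : 'I_n,
            (b == a.+1 :> nat) && (u b < u a)%N]; first by exists a, b.
  move: eu; rewrite (@ascending_perm u) ?ninv1 // => a b eb.
  rewrite ltnNge leq_eqVlt negb_or val_eqE (inj_eq perm_inj) -val_eqE /=.
  apply/andP; split; first lia.
  apply: contra nex => lt_u.
  by apply/existsP; exists a; apply/existsP; exists b; rewrite eb eqxx.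
have := ninv_tperm_down eb lt_u; rewrite eu => -[em].
have /has_expressionP[R [wR eR sR]] := IH _ (esym em).
have lt_b : (0 < b < n)%N by rewrite ltn_ord eb.
have [a' [b' [ea' eb' es]]] := simple_transpE lt_b.
have [{}ea' {}eb'] : a' = a /\ b' = b by split; apply: val_inj; rewrite /=; lia.
apply/has_expressionP; exists (val b :: R); split.
- by rewrite /is_word /= lt_b.
- by rewrite word_perm_cons eR es ea' eb' mulgA tperm2 mul1g.
- by rewrite /= sR -em.
Qed.

(** The Coxeter length is at most [ninv] by [ninv_expression], and [ninv] is at most the length of
    the word; reducedness makes the two ends of this chain meet. *)
Lemma reduced_ninv R : reduced n R -> ninv (word_perm n R) = size R.
Proof.
case/andP=> wR /eqP lR; apply/eqP; rewrite eqn_leq ninv_word_perm //= -lR.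
rewrite /coxeter_length; case: ex_minnP => m _; apply.
exact: ninv_expression.
Qed.

(** Each letter changes [ninv] by exactly one, so a word attaining the bound of [ninv_word_perm]
    attains it on every suffix. *)
Lemma ninv_word_perm_suffix Q R : is_word n (Q ++ R) ->
  ninv (word_perm n (Q ++ R)) = size (Q ++ R) -> ninv (word_perm n R) = size R.
Proof.
elim: Q => [//|i Q IH] /= /andP[i_in wQR]; rewrite word_perm_cons => e.
apply: IH => //; have := ninv_word_perm wQR.
by have := ninv_simple_transp (word_perm n (Q ++ R)) i_in; lia.
Qed.

End Inversions.

(** * Coefficients in the Iwahori-Hecke algebra *)

Section GalleryPolynomials.

Variable n : nat.
Implicit Types (u v : 'S_n) (c : 'S_n -> {poly rat}).

(* Left multiplication by 1 + T_i on the coefficients, in the T_u basis, of an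
   element of the Iwahori-Hecke algebra with T_i^2 = (q - 1) T_i + q. *)
Definition hecke_step (i : nat) c u : {poly rat} :=
  let u' := (simple_transp n i * u)%g in
  if (ninv u < ninv u')%N then c u + 'X * c u' else c u' + 'X * c u.

(** The coefficients of the product of the factors [1 + T_i] over the letters of [R], starting from
    the unit of the algebra. *)
Fixpoint gallery_poly (R : seq nat) : 'S_n -> {poly rat} :=
  if R is i :: R' then hecke_step i (gallery_poly R')
  else fun u => (u == 1%g)%:R.

Lemma eq_hecke_step i c1 c2 : c1 =1 c2 -> hecke_step i c1 =1 hecke_step i c2.
Proof. by move=> ec u; rewrite /hecke_step !ec. Qed.

Lemma hecke_stepB i c1 c2 u :
  hecke_step i (fun v => c1 v - c2 v) u = hecke_step i c1 u - hecke_step i c2 u.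
Proof. by rewrite /hecke_step; case: ifP => _; ring. Qed.

Lemma hecke_stepZ i a c u :
  hecke_step i (fun v => a * c v) u = a * hecke_step i c u.
Proof. by rewrite /hecke_step; case: ifP => _; ring. Qed.

Lemma hecke_step_tperm i (a b : 'I_n) c u : i = a.+1 -> b = a.+1 :> nat ->
  hecke_step i c u =
  if (u a < u b)%N then c u + 'X * c (tperm a b * u)%g
  else c (tperm a b * u)%g + 'X * c u.
Proof.
move=> ei eb; have i_in : (0 < i < n)%N by have := ltn_ord b; lia.
have [a' [b' [ea' eb' es]]] := simple_transpE i_in.
have [{}ea' {}eb'] : a' = a /\ b' = b by split; apply: val_inj; rewrite /=; lia.
by rewrite /hecke_step es ea' eb' ltn_ninv_tperm.
Qed.

(** Only the six permutations of the coset of [u] under the group generated by [s] and [t] occur.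
    Every length comparison among them is decided by the order of [u a], [u b], [u d], and each of
    the six orders leaves a polynomial identity. *)
Lemma hecke_braid i c u : (1 <= i <= n - 2)%N ->
  hecke_step i (hecke_step i.+1 (hecke_step i c)) u
    - hecke_step i.+1 (hecke_step i (hecke_step i.+1 c)) u =
  'X * (hecke_step i c u - hecke_step i.+1 c u).
Proof.
move=> i_in; have lt_a : (i.-1 < n)%N by lia.
have lt_b : (i < n)%N by lia.
have lt_d : (i.+1 < n)%N by lia.
pose a := Ordinal lt_a; pose b := Ordinal lt_b; pose d := Ordinal lt_d.
have ei : i = i.-1.+1 by lia.
have Ei c' v := @hecke_step_tperm i a b c' v ei ei.
have Ej c' v := @hecke_step_tperm i.+1 b d c' v erefl erefl.
have ab : a != b by rewrite -val_eqE /=; lia.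
have bd : b != d by rewrite -val_eqE /=; lia.
have ad : a != d by rewrite -val_eqE /=; lia.
rewrite !(Ei, Ej).
set s := tperm a b; set t := tperm b d.
have sa : s a = b by rewrite tpermL.
have sb : s b = a by rewrite tpermR.
have sd : s d = d by rewrite tpermD // eq_sym.
have ta : t a = a by rewrite tpermD // eq_sym.
have tb : t b = d by rewrite tpermL.
have td : t d = b by rewrite tpermR.
have ss v : (s * (s * v))%g = v by rewrite mulgA tperm2 mul1g.
have tt v : (t * (t * v))%g = v by rewrite mulgA tperm2 mul1g.
have sts v : (t * (s * (t * v)) = s * (t * (s * v)))%g.
  (* Both products are conjugates equal to the transposition of [a] and [d]. *)
  suff e : (t * s * t = s * t * s)%g by rewrite !mulgA e.
  have -> : (t * s * t = s ^ t)%g by rewrite /conjg tpermV mulgA.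
  have -> : (s * t * s = t ^ s)%g by rewrite /conjg tpermV mulgA.
  by rewrite !tpermJ ta tb sb sd.
have ne (x y : 'I_n) : x != y -> u x = u y :> nat -> False.
  by move/eqP=> xy /val_inj/perm_inj.
rewrite !permM !(sa, sb, sd, ta, tb, td) !(ss, tt, sts).
case: (ltngtP (u a) (u b)) => [h1|h1|/ne]; last by case/(_ ab).
  case: (ltngtP (u b) (u d)) => [h2|h2|/ne]; last by case/(_ bd).
    by rewrite (ltn_trans h1 h2); ring.
  by case: (ltngtP (u a) (u d)) => [h3|h3|/ne]; last case/(_ ad); ring.
case: (ltngtP (u b) (u d)) => [h2|h2|/ne]; last by case/(_ bd).
  by case: (ltngtP (u a) (u d)) => [h3|h3|/ne]; last case/(_ ad); ring.
by rewrite ltnNge (ltnW (ltn_trans h2 h1)) /=; ring.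
Qed.

Lemma gallery_poly_gt R u : is_word n R -> (size R < ninv u)%N ->
  gallery_poly R u = 0.
Proof.
elim: R u => [|i R IH] u /=.
  by move=> _; case: eqP => // ->; rewrite ninv1.
case/andP=> i_in wR lt_u; rewrite /hecke_step.
have e := ninv_simple_transp u i_in.
by rewrite !IH ?mulr0 ?addr0 ?if_same //; lia.
Qed.

Lemma gallery_poly_eq R u : is_word n R -> ninv u = size R ->
  gallery_poly R u = (u == word_perm n R)%:R.
Proof.
elim: R u => [|i R IH] u /=; first by rewrite /word_perm big_nil.
case/andP=> i_in wR eu; rewrite /hecke_step.
have wle := ninv_word_perm wR.
have ew : (u == word_perm n (i :: R)) =
          ((simple_transp n i * u)%g == word_perm n R).
  rewrite word_perm_cons; apply/eqP/eqP => [->|<-];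
  by rewrite simple_transpK.
have [e|e] := ninv_simple_transp u i_in.
  rewrite e ltnSn !gallery_poly_gt ?e ?eu ?ltnSn ?mulr0 ?addr0 //.
  by rewrite ew; case: eqP => // e'; exfalso; move: wle; rewrite -e' e eu; lia.
have eR : ninv (simple_transp n i * u)%g = size R by lia.
have -> : (ninv u < ninv (simple_transp n i * u)%g)%N = false by lia.
by rewrite IH // [X in 'X * X]gallery_poly_gt ?eu // mulr0 addr0 ew.
Qed.

(** A factor ['X] could only come from a coefficient at [u] with [u] the permutation of the tail and
    the first letter shortening [u]; then the whole word would not have full length. A size of at
    most 1 means a constant, possibly zero. *)
Lemma gallery_poly_codim1 R u : is_word n R ->
  ninv (word_perm n R) = size R -> (ninv u).+1 = size R ->
  (size (gallery_poly R u) <= 1)%N.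
Proof.
elim: R u => [|i R IH] u //= /andP[i_in wR] iR [eu].
have iR' := @ninv_word_perm_suffix n [:: i] R (introT andP (conj i_in wR)) iR.
rewrite /hecke_step; have [e|e] := ninv_simple_transp u i_in.
  rewrite e ltnSn (gallery_poly_eq wR eu) [X in 'X * X]gallery_poly_gt ?e ?eu //.
  by rewrite mulr0 addr0; case: eqP; rewrite ?size_poly1 ?size_poly0.
have ->: (ninv u < ninv (simple_transp n i * u)%g)%N = false by lia.
rewrite (gallery_poly_eq wR eu); case: eqP => [e'|_].
  by exfalso; move: iR; rewrite word_perm_cons -e'; lia.
by rewrite mulr0 addr0 IH //; lia.
Qed.

Lemma simple_transp_neq i : (1 <= i <= n - 2)%N ->
  simple_transp n i != simple_transp n i.+1.
Proof.
move=> i_in; have /simple_transpE[a [b [ea eb ->]]] : (0 < i < n)%N by lia.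
have /simple_transpE[a' [b' [ea' eb' ->]]] : (0 < i.+1 < n)%N by lia.
apply/eqP => /permP/(_ b'); rewrite tpermR tpermD; last 2 first.
- by rewrite -val_eqE /=; lia.
- by rewrite -val_eqE /=; lia.
by move/(congr1 val); rewrite /=; lia.
Qed.

Lemma gallery_poly_braid_neq Q i R :
  (1 <= i <= n - 2)%N -> (size Q <= 1)%N ->
  reduced n (Q ++ [:: i; i.+1; i] ++ R) ->
  reduced n (Q ++ [:: i.+1; i; i.+1] ++ R) ->
  gallery_poly (Q ++ [:: i; i.+1; i] ++ R) (word_perm n (i :: R)) !=
  gallery_poly (Q ++ [:: i.+1; i; i.+1] ++ R) (word_perm n (i :: R)).
Proof.
move=> i_in sQ red1 red2.
have e1 := reduced_ninv red1; have e2 := reduced_ninv red2.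
have {red1 red2} [w1 w2] := (proj1 (andP red1), proj1 (andP red2)).
(* The words [i :: R] and [i.+1 :: R] are suffixes of the two reduced words, hence both have full
   length. *)
have suff1 : Q ++ [:: i; i.+1; i] ++ R = (Q ++ [:: i; i.+1]) ++ i :: R.
  by rewrite -catA.
have suff2 : Q ++ [:: i.+1; i; i.+1] ++ R = (Q ++ [:: i.+1; i]) ++ i.+1 :: R.
  by rewrite -catA.
have nA := ninv_word_perm_suffix (etrans (congr1 (is_word n) (esym suff1)) w1) _.
have {e1}/nA nA : ninv (word_perm n ((Q ++ [:: i; i.+1]) ++ i :: R)) =
    size ((Q ++ [:: i; i.+1]) ++ i :: R) by rewrite -suff1.
have nB := ninv_word_perm_suffix (etrans (congr1 (is_word n) (esym suff2)) w2) _.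
have {e2}/nB nB : ninv (word_perm n ((Q ++ [:: i.+1; i]) ++ i.+1 :: R)) =
    size ((Q ++ [:: i.+1; i]) ++ i.+1 :: R) by rewrite -suff2.
have wA : is_word n (i :: R).
  by move: w1; rewrite suff1 /is_word all_cat => /andP[].
have wB : is_word n (i.+1 :: R).
  by move: w2; rewrite suff2 /is_word all_cat => /andP[].
set x := word_perm n (i :: R) in nA *.
have Ax : gallery_poly (i :: R) x = 1 by rewrite gallery_poly_eq // eqxx.
(* The permutation [x] is as long as the word [i.+1 :: R] but is not its permutation, so its
   coefficient is 0 and not 1. *)
have Bx : gallery_poly (i.+1 :: R) x = 0.
  rewrite gallery_poly_eq // /x !word_perm_cons (inj_eq (mulIg _)).
  by rewrite (negPf (simple_transp_neq i_in)).
rewrite -subr_eq0; case: Q sQ w1 {w2 suff1 suff2} => [|k [|//]] _ w1.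
  rewrite /= hecke_braid // -!/(gallery_poly (_ :: _)) Ax Bx subr0 mulr1.
  by rewrite polyX_eq0.
have /andP[k_in _] : is_word n (k :: [:: i; i.+1; i] ++ R) by [].
(* By linearity of the step for [k], the braid difference passes inside it and the factor ['X] comes
   out. *)
rewrite /= -hecke_stepB (eq_hecke_step _ (fun u => hecke_braid _ u i_in)).
rewrite hecke_stepZ mulf_neq0 ?polyX_eq0 // hecke_stepB.
rewrite -!/(gallery_poly (_ :: _)) /(hecke_step k).
have [e|e] := ninv_simple_transp x k_in.
  rewrite e ltnSn Ax Bx !gallery_poly_gt ?e ?nA //.
  by rewrite mulr0 !addr0 subr0 oner_neq0.
have -> : (ninv x < ninv (simple_transp n k * x)%g)%N = false by lia.
rewrite Ax Bx mulr1 mulr0 addr0.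
have /gallery_poly_codim1 : (ninv (simple_transp n k * x)%g).+1 = size (i :: R).
  by rewrite -e nA.
move=> /(_ wA nA); set p := gallery_poly _ _ => sp.
have /gallery_poly_codim1 :
    (ninv (simple_transp n k * x)%g).+1 = size (i.+1 :: R) by rewrite -e nA.
move=> /(_ wB nB); set r := gallery_poly _ _ => sr.
(* What remains is [p - r + 'X] with [p] and [r] constant: its vanishing would make [p - r], of size
   at most 1, equal to [- 'X], of size 2. *)
rewrite addrAC addr_eq0; apply/eqP => /(congr1 (fun p' : {poly _} => size p')).
rewrite size_polyN size_polyX => s2; have := size_polyD p (- r).
by rewrite size_polyN s2 => /leq_trans/(_ (_ : _ <= 1)%N);
  rewrite geq_max sp sr => /(_ isT).
Qed.

End GalleryPolynomials.

(** * Coordinate flags and the linear action on flags *)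

Section FlagAction.

Variables (F : finFieldType) (n : nat).
Implicit Types (v w : 'S_n) (f : subspace_seq F n) (g h : 'M[F]_n) (x : 'cV[F]_n).

Lemma mem_coord_flag v (k : 'I_n.+1) x :
  reflect (forall j : 'I_n, (k <= j)%N -> x (v j) 0 = 0) (x \in coord_flag F v k).
Proof.
rewrite ffunE; apply: (iffP memv_sumP) => [[y yP ->] j le_kj|x0].
  rewrite summxE big1 // => j' lt_j'k.
  have /vlineP[c ->] := yP _ lt_j'k; rewrite !mxE (inj_eq perm_inj) -val_eqE.
  by rewrite (gtn_eqF (leq_trans lt_j'k le_kj)) mulr0.
exists (fun j => x (v j) 0 *: delta_mx (v j) 0).
  by move=> j _; apply: memvZ; apply: memv_line.
rewrite {1}[x]matrix_sum_delta (reindex_inj (@perm_inj _ v)) /= [RHS]big_mkcond.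
apply: eq_bigr => j _; rewrite big_ord1; case: ltnP => // /x0 ->.
by rewrite scale0r.
Qed.

(** The first [k] coordinate lines and the other [n - k] span spaces of dimension at most [k] and
    [n - k]; together they fill the whole space, so both bounds are attained. *)
Lemma dim_coord_flag v (k : 'I_n.+1) : \dim (coord_flag F v k) = k.
Proof.
have dim_lines (P : pred 'I_n) :
    (\dim (\sum_(j | P j) <[delta_mx (v j) ord0 : 'cV[F]_n]>)%VS
       <= \sum_(j | P j) 1)%N.
  apply: leq_trans (dimv_leq_sum _ _ _) _; apply: leq_sum => j _.
  by rewrite dim_vline leq_b1.
have cardP : (\sum_(j < n | (j < k)%N) 1 = k)%N.
  by rewrite -(big_ord_widen n (fun _ => 1%N) (leq_ord k)) sum1_card card_ord.
have sum_all : (\sum_(j < n | (j < k)%N) 1 + \sum_(j < n | ~~ (j < k)%N) 1 = n)%N.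
  have : (\sum_(j < n) 1 = n)%N by rewrite sum1_card card_ord.
  by rewrite (bigID (fun j : 'I_n => (j < k)%N)).
have le_k := dim_lines (fun j : 'I_n => (j < k)%N).
have le_nk := dim_lines (fun j : 'I_n => ~~ (j < k)%N).
rewrite cardP in le_k sum_all.
apply/eqP; rewrite eqn_leq {1}ffunE le_k /=.
have : (\dim (fullv : {vspace 'cV[F]_n}) <= \dim (coord_flag F v k +
   \sum_(j < n | ~~ (j < k)%N) <[delta_mx (v j) ord0 : 'cV[F]_n]>)%VS)%N.
  apply/dimvS/subvP => x _; rewrite {1}[x]matrix_sum_delta.
  apply: memv_suml => j _; rewrite big_ord1 memvZ //.
  have [j' ->] : exists j', j = v j' by exists (v^-1 j)%g; rewrite permKV.
  case: (ltnP j' k) => ltjk.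
    rewrite (subvP (addvSl _ _)) // ffunE (subvP _ _ (memv_line _)) //.
    by rewrite (sumv_sup j').
  rewrite (subvP (addvSr _ _)) // (subvP _ _ (memv_line _)) //.
  by rewrite (sumv_sup j') // -leqNgt.
move/leq_trans => /(_ _ ((dimv_add_leqif _ _).1)); rewrite dimvf /dim /= muln1.
by move=> /leq_trans/(_ (leq_add (leqnn _) le_nk)); rewrite -{1}sum_all leq_add2r.
Qed.

Lemma coord_is_flag v : is_flag (coord_flag F v).
Proof.
apply/andP; split; first by apply/forallP => k; rewrite dim_coord_flag.
apply/forallP => j; apply/forallP => k; apply/implyP => le_jk.
apply/subvP => x /mem_coord_flag x0; apply/mem_coord_flag => l le_kl.
exact: x0 (leq_trans le_jk le_kl).
Qed.

Lemma flag_actM g h f : flag_act (g *m h) f = flag_act g (flag_act h f).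
Proof.
apply/ffunP => k; rewrite !ffunE -limg_comp; congr (_ @: _)%VS.
by apply/lfunP => x; rewrite comp_lfunE !lfunE /= mulmxA.
Qed.

Lemma flag_act1 f : flag_act 1%:M f = f.
Proof.
apply/ffunP => k; rewrite !ffunE -[RHS]lim1g; congr (_ @: _)%VS.
by apply/lfunP => x; rewrite id_lfunE lfunE /= mul1mx.
Qed.

Lemma flag_actK g : g \in unitmx -> cancel (flag_act g) (flag_act (invmx g)).
Proof. by move=> ug f; rewrite -flag_actM mulVmx // flag_act1. Qed.

Lemma memv_flag_act g f k x : x \in f k -> g *m x \in flag_act g f k.
Proof.
by move=> fx; rewrite ffunE; apply/memv_imgP; exists x; rewrite ?lfunE.
Qed.

Lemma flag_actP g f k x :
  x \in flag_act g f k -> exists2 y, y \in f k & x = g *m y.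
Proof. by rewrite ffunE => /memv_imgP[y fy ->]; exists y; rewrite ?lfunE. Qed.

Lemma dim_flag_act g f k : g \in unitmx -> \dim (flag_act g f k) = \dim (f k).
Proof.
move=> ug; rewrite ffunE limg_dim_eq //; apply/eqP; rewrite -subv0.
apply/subvP => x /memv_capP[_]; rewrite memv_ker lfunE /= memv0 => /eqP gx0.
by rewrite -[x](mulKmx ug) gx0 mulmx0.
Qed.

Lemma is_flag_act g f : g \in unitmx -> is_flag f -> is_flag (flag_act g f).
Proof.
move=> ug /andP[/forallP dimf /forallP subf]; apply/andP; split.
  by apply/forallP => k; rewrite dim_flag_act.
apply/forallP => j; apply/forallP => k; apply/implyP => le_jk; rewrite !ffunE.
by apply/limgS/(implyP (forallP (subf j) k)).
Qed.

Lemma is_flag_actE g f : g \in unitmx -> is_flag (flag_act g f) = is_flag f.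
Proof.
move=> ug; apply/idP/idP; last exact: is_flag_act.
by move/(is_flag_act (_ : invmx g \in unitmx)); rewrite flag_actK ?unitmx_inv // => ->.
Qed.

(** Column [v j] of [g] is the image of the basis vector that enters the flag of [v] at index
    [j.+1]; the vanishing entries say that it lies in the member of that index for [w]. Equal
    dimensions turn inclusion into equality. *)
Lemma flag_act_coordP g v w : g \in unitmx ->
  reflect (forall j k : 'I_n, (j < k)%N -> g (w k) (v j) = 0)
          (flag_act g (coord_flag F v) == coord_flag F w).
Proof.
move=> ug; apply: (iffP eqP) => [gvw j k lt_jk|g0].
  have lt_jn : (j.+1 < n.+1)%N by rewrite ltnS.
  have ej : delta_mx (v j) 0 \in coord_flag F v (Ordinal lt_jn).
    apply/mem_coord_flag => l /= lt_jl; rewrite mxE (inj_eq perm_inj) -val_eqE.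
    by rewrite gtn_eqF.
  have := memv_flag_act g ej; rewrite gvw -colE => /mem_coord_flag/(_ k lt_jk).
  by rewrite mxE.
apply/ffunP => k; apply/eqP; rewrite eqEdim dim_flag_act // !dim_coord_flag leqnn.
rewrite andbT; apply/subvP => x /flag_actP[y /mem_coord_flag y0 ->].
apply/mem_coord_flag => j le_kj; rewrite mxE (reindex_inj (@perm_inj _ v)) big1 //.
move=> l _ /=; case: (ltnP l k) => [lt_lk|/y0 ->]; last by rewrite mulr0.
by rewrite g0 ?mul0r // (leq_trans lt_lk le_kj).
Qed.

Definition transvection (c : F) (p q : 'I_n) : 'M[F]_n :=
  1%:M + c *: delta_mx p q.

Lemma transvection_mulE c p q x j :
  (transvection c p q *m x) j 0 = x j 0 + (j == p)%:R * (c * x q 0).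
Proof.
rewrite mulmxDl mul1mx mxE; congr (_ + _); rewrite -scalemxAl !mxE.
rewrite (bigD1 q) //= big1 => [|l /negPf lq]; rewrite mxE ?eqxx ?andbT ?lq.
  by case: eqP => _; rewrite /= ?addr0 ?mul0r ?mul1r ?mulr0.
by rewrite andbF mul0r.
Qed.

Lemma transvection_unit c p q : p != q -> transvection c p q \in unitmx.
Proof.
rewrite eq_sym => qp; apply: proj1 (mulmx1_unit (_ : _ *m transvection (- c) p q = _)).
rewrite /transvection mulmxDl mul1mx mulmxDr mulmx1 -scalemxAl -scalemxAr.
by rewrite mul_delta_mx_0 // !scaler0 addr0 scaleNr addrNK.
Qed.

(** The matrix adds a multiple of the basis vector [p] to the basis vector [q], and [p] enters the
    flag of [v] before [q]. *)
Lemma transvection_fix c v p q : (v^-1%g p < v^-1%g q)%N ->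
  flag_act (transvection c p q) (coord_flag F v) = coord_flag F v.
Proof.
move=> lt_pq; have pq : p != q by apply: contraTneq lt_pq => ->; rewrite ltnn.
apply/eqP/flag_act_coordP => [|j k lt_jk]; first exact: transvection_unit.
rewrite !mxE (inj_eq perm_inj) -val_eqE (gtn_eqF lt_jk) add0r.
case: (v k =P p) => [ek|_] /=; last by rewrite mulr0.
case: (v j =P q) => [ej|_] /=; last by rewrite mulr0.
by move: lt_pq; rewrite -ek -ej !permK; lia.
Qed.

Lemma perm_mx_mulE (s : 'S_n) x j : (perm_mx s *m x) j 0 = x (s j) 0.
Proof. by rewrite -row_permE mxE. Qed.

(** The inverse appears because [perm_mx s] sends the basis vector of index [s j] to that of index
    [j]. *)
Lemma flag_act_perm (s : 'S_n) v :
  flag_act (perm_mx s^-1) (coord_flag F v) = coord_flag F (v * s)%g.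
Proof.
apply/eqP/flag_act_coordP => [|j k lt_jk]; first exact: unitmx_perm.
by rewrite !mxE permM permK (inj_eq perm_inj) -val_eqE (gtn_eqF lt_jk).
Qed.

Lemma coord_flag_eq1 v : (coord_flag F v == std_flag F n) = (v == 1%g).
Proof.
apply/idP/eqP => [|-> //]; rewrite -[coord_flag F v]flag_act1.
move/(flag_act_coordP _ _ (unitmx1 _ _)) => v0.
have le_v j : (v j <= j)%N.
  rewrite leqNgt; apply/negP => /v0; rewrite perm1 !mxE eqxx.
  by move/eqP; rewrite oner_eq0.
(* If [v j < j], the induction hypothesis says that [v] fixes [v j], and injectivity gives
   [v j = j]. *)
apply/permP => j; rewrite perm1; have [m] := ubnP (j : nat).
elim: m j => // m IH j lt_jm; apply/val_inj/eqP; rewrite eqn_leq le_v leqNgt /=.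
apply/negP => lt_vj; have /perm_inj ej := IH (v j) (leq_trans lt_vj lt_jm).
by move: lt_vj; rewrite ej ltnn.
Qed.

End FlagAction.

(** * Counting galleries by their first step *)

Section Galleries.

Variables (F : finFieldType) (n : nat).
Implicit Types (f h : subspace_seq F n) (v : 'S_n).

Definition adjacent (i : nat) f h : bool :=
  [forall k : 'I_n.+1, (k != i :> nat) ==> (f k == h k)].

Lemma adjacentP i f h :
  reflect (forall k : 'I_n.+1, k != i :> nat -> f k = h k) (adjacent i f h).
Proof.
by apply: (iffP forallP) => fh k; [move/(implyP (fh k))/eqP|apply/implyP => /fh ->].
Qed.

(** The recursion consumes the first letter, to match that of [gallery_poly]; this moves the
    starting flag, which is therefore an argument. *)
Fixpoint galleries (R : seq nat) f h : nat :=
  if R is i :: R' then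
    \sum_(f' | is_flag f' && adjacent i f f') galleries R' f' h
  else f == h.

Lemma adjacent_act g i f h : g \in unitmx ->
  adjacent i (flag_act g f) (flag_act g h) = adjacent i f h.
Proof.
move=> ug; have act g' f' h' : adjacent i f' h' ->
    adjacent i (flag_act g' f') (flag_act g' h').
  by move/adjacentP => fh; apply/adjacentP => k ki; rewrite !ffunE fh.
apply/idP/idP; last exact: act.
by move/(act (invmx g)); rewrite !flag_actK.
Qed.

Lemma galleries_act g R f h : g \in unitmx ->
  galleries R (flag_act g f) (flag_act g h) = galleries R f h.
Proof.
move=> ug; elim: R f => [|i R IH] f /=.
  by rewrite (inj_eq (can_inj (flag_actK ug))).
rewrite (reindex_inj (can_inj (flag_actK ug))) /=.
by apply: eq_big => [f'|f' _]; rewrite ?IH // is_flag_actE // adjacent_act.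
Qed.

Variables (a b : 'I_n) (eb : b = a.+1 :> nat).

(** With [e_a], [e_b] the basis vectors, this matrix sends [e_a] to [e_b + t e_a]. Applied to the
    standard flag, it gives the affine chart of the projective line of flags that may differ from it
    only at index [a.+1]. *)
Definition cross (t : F) : 'M[F]_n := transvection t a b *m perm_mx (tperm a b).

Let ab : a != b. Proof. by rewrite -val_eqE /= eb; lia. Qed.

Lemma cross_unit t : cross t \in unitmx.
Proof. by rewrite unitmx_mul transvection_unit ?unitmx_perm. Qed.

Lemma cross_mulE t (x : 'cV[F]_n) j :
  (cross t *m x) j 0 = x (tperm a b j) 0 + (j == a)%:R * (t * x a 0).
Proof. by rewrite -mulmxA transvection_mulE !perm_mx_mulE tpermR. Qed.

Lemma flag_act_cross t v : flag_act (cross t) (coord_flag F v) =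
  flag_act (transvection t a b) (coord_flag F (v * tperm a b)%g).
Proof. by rewrite flag_actM -flag_act_perm tpermV. Qed.

Lemma cross_adjacent t :
  adjacent a.+1 (std_flag F n) (flag_act (cross t) (std_flag F n)).
Proof.
apply/adjacentP => k nk; apply/esym/eqP.
rewrite eqEdim dim_flag_act ?cross_unit // leqnn andbT; apply/subvP => x.
move=> /flag_actP[y /mem_coord_flag y0 ->]; apply/mem_coord_flag => j le_kj.
have {}y0 (l : 'I_n) : (k <= l)%N -> y l 0 = 0 by move/y0; rewrite perm1.
rewrite perm1 cross_mulE y0.
  case: (j =P a) => [ja|_]; last by rewrite mul0r addr0.
  by rewrite y0 ?mulr0 ?addr0 // -ja.
by case: tpermP => [ja|jb|] //; move: nk; subst; lia.
Qed.

(** Modulo the member of index [a], the member of index [a.+1] is a line; [x] spans it, and the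
    parameter is the slope of [x] in the coordinates [a] and [b]. *)
Lemma adjacent_cross f (x : 'cV[F]_n) (k : 'I_n.+1) :
  is_flag f -> adjacent a.+1 (std_flag F n) f -> k = a.+1 :> nat ->
  x \in f k -> x b 0 != 0 ->
  f = flag_act (cross (x a 0 / x b 0)) (std_flag F n).
Proof.
move=> /andP[/forallP dimf /forallP subf] /adjacentP adjf ek fx xb.
set t := _ / _; have /adjacentP adjt := cross_adjacent t.
apply/ffunP => l; have [el|nl] := eqVneq (l : nat) a.+1; last first.
  by rewrite -adjf // adjt.
have {}el : l = k by apply: val_inj; rewrite /= el ek.
subst l; apply/esym/eqP; rewrite eqEdim dim_flag_act ?cross_unit //.
rewrite dim_coord_flag (eqP (dimf k)) leqnn andbT.
apply/subvP => z /flag_actP[y /mem_coord_flag y0 ->].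
have {}y0 (j : 'I_n) : (a < j)%N -> y j 0 = 0.
  by move=> lt_aj; have := y0 j; rewrite perm1 ek; apply.
have lt_an : (a < n.+1)%N by rewrite ltnS ltnW.
have fl : (f (Ordinal lt_an) <= f k)%VS.
  by apply: (implyP (forallP (subf _) k)); rewrite /= ek.
(* The multiple of [x] is chosen to cancel the coordinate [b]; the choice of [t] then cancels the
   coordinate [a] too, leaving a vector of the common member of index [a]. *)
rewrite -[_ *m y](subrK ((y a 0 / x b 0) *: x)) memvD ?memvZ //.
apply: (subvP fl); rewrite -adjf /=; last by lia.
apply/mem_coord_flag => j /= le_aj; rewrite perm1.
rewrite [LHS]mxE cross_mulE [in X in _ + X]mxE [in X in _ + X]mxE /t.
have [ja|ja] := eqVneq j a.
  by rewrite ja tpermL y0 ?eb //=; field.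
have [jb|jb] := eqVneq j b.
  by rewrite jb tpermR /=; field.
rewrite tpermD 1?eq_sym // y0 /=; last by rewrite ltn_neqAle le_aj andbT eq_sym.
suff -> : x j 0 = 0 by rewrite !mul0r !mulr0 subr0 addr0.
have lt_bn : (b.+1 < n.+1)%N by rewrite ltnS.
have fb : (f k <= f (Ordinal lt_bn))%VS.
  by apply: (implyP (forallP (subf _) _)); rewrite /= ek eb.
have := subvP fb _ fx; rewrite -adjf /=; last by lia.
move/mem_coord_flag/(_ j); rewrite perm1; apply; rewrite /=.
by move: ja jb; rewrite -!val_eqE /=; lia.
Qed.

Lemma cross_inj : injective (fun t => flag_act (cross t) (std_flag F n)).
Proof.
move=> t t' /ffunP e; have lt_a : (a.+1 < n.+1)%N by rewrite ltnS.
have sa : delta_mx a 0 \in std_flag F n (Ordinal lt_a).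
  apply/mem_coord_flag => j /= lt_aj; rewrite perm1 mxE -val_eqE.
  by rewrite gtn_eqF.
have := memv_flag_act (cross t) sa; rewrite e.
move=> /flag_actP[y /mem_coord_flag/(_ b) + ey]; rewrite perm1 /= eb => /(_ (ltnSn _)) yb.
have := congr1 (fun z : 'cV_n => z b 0) ey.
have := congr1 (fun z : 'cV_n => z a 0) ey.
rewrite /= !cross_mulE tpermL tpermR !mxE !eqxx (eq_sym b a) (negPf ab) /= yb.
by rewrite !mul0r !mul1r !addr0 mulr1 !add0r => -> <-; rewrite mulr1.
Qed.

Lemma cross_neq_std t : flag_act (cross t) (std_flag F n) != std_flag F n.
Proof.
apply/negP => /flag_act_coordP-/(_ (cross_unit t) a b); rewrite !perm1 eb ltnSn.
move/(_ isT); have -> : cross t b a = (cross t *m (delta_mx a 0 : 'cV_n)) b 0.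
  by rewrite -colE [RHS]mxE.
rewrite cross_mulE tpermR !mxE !eqxx (eq_sym b a) (negPf ab) mul0r addr0.
by move/eqP; rewrite oner_eq0.
Qed.

(** A vector [x] of the new member outside the standard one still lies in the common member of index
    [a.+2], so its coordinate [b] is nonzero and [adjacent_cross] applies. *)
Lemma std_adjacent f : is_flag f -> adjacent a.+1 (std_flag F n) f ->
  f = std_flag F n \/ exists t, f = flag_act (cross t) (std_flag F n).
Proof.
move=> flf adjf; have lt_a : (a.+1 < n.+1)%N by rewrite ltnS.
set k := Ordinal lt_a; have /andP[/forallP dimf /forallP subf] := flf.
have [le_f|/subvPn[x fx]] := boolP (f k <= std_flag F n k)%VS.
  left; apply/ffunP => l; have [el|nl] := eqVneq (l : nat) a.+1; last first.
    by rewrite (adjacentP _ _ _ adjf).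
  have -> : l = k by apply: val_inj.
  by apply/eqP; rewrite eqEdim le_f dim_coord_flag (eqP (dimf k)) leqnn.
move=> nx; right; exists (x a 0 / x b 0).
have := adjacent_cross flf adjf (erefl : k = a.+1 :> nat) fx; apply.
apply: contra nx => /eqP xb.
apply/mem_coord_flag => j /= lt_aj; rewrite perm1.
have [-> //|jb] := eqVneq j b.
have lt_bn : (b.+1 < n.+1)%N by rewrite ltnS.
have fb : (f k <= f (Ordinal lt_bn))%VS.
  by apply: (implyP (forallP (subf _) _)); rewrite /= eb.
have := subvP fb _ fx; rewrite -(adjacentP _ _ _ adjf) /=; last by lia.
move/mem_coord_flag/(_ j); rewrite perm1; apply; rewrite /=.
by move: jb; rewrite -!val_eqE /=; lia.
Qed.

Lemma sum_adjacent (T : nmodType) (c : subspace_seq F n -> T) :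
  \sum_(f | is_flag f && adjacent a.+1 (std_flag F n) f) c f =
  c (std_flag F n) + \sum_t c (flag_act (cross t) (std_flag F n)).
Proof.
pose ph t := flag_act (cross t) (std_flag F n).
transitivity (\sum_(f in std_flag F n |: [set ph t | t : F]) c f).
  apply: eq_bigl => f; rewrite !inE; apply/andP/orP.
    case=> flf /(std_adjacent flf)[->|[t ->]]; first by left.
    by right; apply/imsetP; exists t.
  case=> [/eqP ->|/imsetP[t _ ->]]; split.
  - exact: coord_is_flag.
  - exact/adjacentP.
  - exact: is_flag_act (cross_unit t) (coord_is_flag _ _).
  - exact: cross_adjacent.
rewrite big_setU1 /=; last first.
  by apply/imsetP => -[t _ e]; have := cross_neq_std t; rewrite -/(ph t) -e eqxx.
by congr (_ + _); rewrite big_imset //= => t t' _ _ /cross_inj.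
Qed.

(** The image of [e_a] is [e_a + c e_b], proportional to [e_b + c^-1 e_a]. *)
Lemma transvection_std c : c != 0 ->
  flag_act (transvection c b a) (std_flag F n) =
  flag_act (cross c^-1) (std_flag F n).
Proof.
move=> c0; have ut : transvection c b a \in unitmx.
  by rewrite transvection_unit // eq_sym.
have lt_a : (a.+1 < n.+1)%N by rewrite ltnS.
pose x : 'cV[F]_n := transvection c b a *m delta_mx a 0.
have xa : x a 0 = 1.
  by rewrite transvection_mulE !mxE !eqxx (negPf ab) mul0r addr0.
have xb : x b 0 = c.
  by rewrite transvection_mulE !mxE !eqxx (eq_sym b a) (negPf ab) mul1r mulr1 add0r.
have -> : c^-1 = x a 0 / x b 0 by rewrite xa xb mul1r.
apply: (@adjacent_cross _ x (Ordinal lt_a)); rewrite ?xb //.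
- exact: is_flag_act (coord_is_flag _ _).
- apply/adjacentP => k nk; apply/esym/eqP.
  rewrite eqEdim dim_flag_act // leqnn andbT; apply/subvP => z.
  move=> /flag_actP[y /mem_coord_flag y0 ->]; apply/mem_coord_flag => j le_kj.
  rewrite transvection_mulE y0 // perm1 add0r; case: (j =P b) => [jb|_].
    have := y0 a; rewrite perm1 => ->; rewrite ?mulr0 //.
    by move: nk le_kj; rewrite jb eb; lia.
  by rewrite mul0r.
apply: memv_flag_act; apply/mem_coord_flag => j /= lt_aj.
by rewrite perm1 mxE -val_eqE gtn_eqF.
Qed.

(** Translation by [cross t] moves both ends at once: it takes the flag of [v * tperm a b] to that
    of [v], since the transvection fixes the latter. *)
Lemma galleries_cross_up R t v : (v^-1%g a < v^-1%g b)%N ->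
  galleries R (flag_act (cross t) (std_flag F n)) (coord_flag F v) =
  galleries R (std_flag F n) (coord_flag F (v * tperm a b)%g).
Proof.
move=> lt_v; rewrite -[in RHS](galleries_act _ _ _ (cross_unit t)).
by rewrite flag_act_cross -mulgA tperm2 mulg1 transvection_fix.
Qed.

Lemma galleries_cross0 R v :
  galleries R (flag_act (cross 0) (std_flag F n)) (coord_flag F v) =
  galleries R (std_flag F n) (coord_flag F (v * tperm a b)%g).
Proof.
rewrite -[in RHS](galleries_act _ _ _ (cross_unit 0)) flag_act_cross.
by rewrite -mulgA tperm2 mulg1 /transvection scale0r addr0 flag_act1.
Qed.

(** Here the opposite transvection fixes the flag of [v], and by [transvection_std] it carries the
    standard flag to the given start. *)
Lemma galleries_cross_down R t v : t != 0 -> (v^-1%g b < v^-1%g a)%N ->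
  galleries R (flag_act (cross t) (std_flag F n)) (coord_flag F v) =
  galleries R (std_flag F n) (coord_flag F v).
Proof.
move=> t0 lt_v; rewrite -{1}[t]invrK -transvection_std ?invr_eq0 //.
rewrite -{1}(transvection_fix t^-1 lt_v) galleries_act //.
by rewrite transvection_unit // eq_sym.
Qed.

End Galleries.

(** The first step has [q + 1] choices: staying, and the [q] values of [t]. If [v^-1] ascends at
    [a], every [t] contributes the count for [v * tperm a b]; if it descends, only [t = 0] does, and
    the other [q - 1] values repeat the count for [v]. These are the two branches of [hecke_step] at
    [v^-1]. *)
Lemma galleries_gallery_poly (F : finFieldType) n R (v : 'S_n) : is_word n R ->
  (galleries R (std_flag F n) (coord_flag F v))%:R =
  (gallery_poly R v^-1%g).[#|F|%:R].
Proof.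
elim: R v => [|i R IH] v /=.
  rewrite [_ == coord_flag F v]eq_sym coord_flag_eq1 -(inj_eq invg_inj) invg1.
  by case: eqP => _; rewrite hornerE.
case/andP=> i_in wR; have [a [b [-> eb _]]] := simple_transpE i_in.
rewrite (hecke_step_tperm _ _ erefl eb) (sum_adjacent eb).
have eg : (tperm a b * v^-1)%g = ((v * tperm a b)^-1)%g by rewrite invMg tpermV.
rewrite eg; case: (ltnP (v^-1%g a) (v^-1%g b)) => [lt_v|].
  rewrite (eq_bigr _ (fun t _ => galleries_cross_up eb R t lt_v)).
  by rewrite sum_nat_const natrD natrM !IH // !hornerE.
rewrite leq_eqVlt => /orP[/eqP/val_inj/perm_inj ba|lt_v].
  by move: eb; rewrite ba; lia.
rewrite (bigD1 0) //= galleries_cross0 //.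
rewrite (eq_bigr _ (fun t t0 => galleries_cross_down eb R t0 lt_v)).
rewrite sum_nat_const cardC1 !natrD natrM !IH // !hornerE.
have -> : #|F|%:R = (#|F|.-1)%:R + 1 :> rat.
  by rewrite natr1 prednK //; apply/card_gt0P; exists 0.
by rewrite /=; ring.
Qed.

(** * From the recursive count to the points of the Bott-Samelson variety *)

Section GallerySets.

Variables (F : finFieldType) (n : nat).
Implicit Types (f h : subspace_seq F n).

(** The Bott-Samelson conditions with a free starting flag, as induction on the word requires. *)
Definition is_gallery (R : seq nat) f
    (Fs : {ffun 'I_(size R).+1 -> subspace_seq F n}) : bool :=
  [&& [forall r, is_flag (Fs r)], Fs ord0 == f &
      [forall r : 'I_(size R),
         adjacent (nth 0%N R r) (Fs (widen_ord (leqnSn _) r)) (Fs (lift ord0 r))]].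

Definition gallery_cons m f (Fs : {ffun 'I_m -> subspace_seq F n}) :
  {ffun 'I_m.+1 -> subspace_seq F n} := [ffun r => oapp Fs f (unlift ord0 r)].

Lemma gallery_cons0 m f (Fs : {ffun 'I_m -> subspace_seq F n}) :
  gallery_cons f Fs ord0 = f.
Proof. by rewrite ffunE unlift_none. Qed.

Lemma gallery_cons_lift m f (Fs : {ffun 'I_m -> subspace_seq F n}) r :
  gallery_cons f Fs (lift ord0 r) = Fs r.
Proof. by rewrite ffunE liftK. Qed.

Lemma is_gallery_cons i R f (Fs : {ffun 'I_(size R).+1 -> subspace_seq F n}) :
  is_flag f ->
  @is_gallery (i :: R) f (gallery_cons f Fs) =
  adjacent i f (Fs ord0) && is_gallery (Fs ord0) Fs.
Proof.
move=> flf; rewrite /is_gallery gallery_cons0 !eqxx /=.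
have w0 : widen_ord (leqnSn (size (i :: R))) ord0 = ord0 by apply: val_inj.
have wl (r : 'I_(size R)) : widen_ord (leqnSn (size (i :: R))) (lift ord0 r) =
  lift ord0 (widen_ord (leqnSn _) r) by apply: val_inj.
apply/andP/and3P => [[/forallP fl /forallP ad]|[ad0 /forallP fl /forallP ad]].
  split.
  - by have := ad ord0; rewrite w0 gallery_cons0 gallery_cons_lift.
  - by apply/forallP => r; have := fl (lift ord0 r); rewrite gallery_cons_lift.
  apply/forallP => r; have := ad (lift ord0 r).
  by rewrite wl !gallery_cons_lift.
split; apply/forallP => r; case: (unliftP ord0 r) => [r'|] ->.
- by rewrite gallery_cons_lift.
- by rewrite gallery_cons0.
- by rewrite wl !gallery_cons_lift; apply: ad.
by rewrite w0 gallery_cons0 gallery_cons_lift.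
Qed.

(** Galleries are sorted by their flag number 1, and those with a given one correspond to their
    tails. *)
Lemma card_is_gallery R f h : is_flag f ->
  #|[set Fs | is_gallery f Fs && (Fs (@ord_max (size R)) == h)]| =
  galleries R f h.
Proof.
elim: R f => [|i R IH] f flf.
  have mem_s (Fs : {ffun 'I_1 -> subspace_seq F n}) :
      @is_gallery [::] f Fs = (Fs == [ffun=> f]).
    apply/and3P/eqP => [[_ /eqP f0 _]|->].
      by apply/ffunP => r; rewrite ffunE ord1.
    split; last by apply/forallP => -[].
      by apply/forallP => r; rewrite ffunE.
    by rewrite ffunE.
  rewrite /=; case: (f =P h) => [<-|nfh].
    rewrite (_ : [set _ | _] = [set [ffun=> f]]) ?cards1 //.
    by apply/setP => Fs; rewrite !inE mem_s; case: eqP => // ->; rewrite ffunE eqxx.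
  apply: eq_card0 => Fs; rewrite !inE mem_s; case: eqP => // ->.
  by rewrite ffunE; apply/eqP.
rewrite -sum1_card (partition_big
  (fun Fs : {ffun 'I_(size R).+2 -> _} => Fs (lift ord0 ord0))
  (fun f' => is_flag f' && adjacent i f f')) /=; last first.
  move=> Fs; rewrite inE => /andP[/and3P[/forallP fl /eqP f0 /forallP ad] _].
  rewrite fl /=; have := ad ord0; rewrite /= -f0; congr (adjacent _ (Fs _) _).
  exact: val_inj.
apply: eq_bigr => f' /andP[flf' adf']; rewrite -IH // -sum1_card.
rewrite (reindex_onto (@gallery_cons _ f)
  (fun Fs : {ffun 'I_(size R).+2 -> _} => [ffun r => Fs (lift ord0 r)])) /=.
  apply: eq_bigl => Fs; rewrite !inE is_gallery_cons // gallery_cons_lift.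
  have -> : [ffun r => gallery_cons f Fs (lift ord0 r)] = Fs.
    by apply/ffunP => r; rewrite ffunE gallery_cons_lift.
  have -> : (ord_max : 'I_(size R).+2) = lift ord0 ord_max by apply: val_inj.
  rewrite gallery_cons_lift eqxx andbT.
  have [e0|nf'] := eqVneq (Fs ord0) f'; first by rewrite e0 adf' andbT.
  by rewrite andbF /is_gallery (negPf nf') andbF.
move=> Fs; rewrite inE => /andP[/andP[/and3P[_ /eqP f0 _] _] _].
apply/ffunP => r; case: (unliftP ord0 r) => [r'|] ->.
  by rewrite gallery_cons_lift ffunE.
by rewrite gallery_cons0.
Qed.

Lemma card_bott_samelson R (X : {set subspace_seq F n}) :
  #|[set Fs in bott_samelson F n R | bs_proj Fs \in X]| =
  (\sum_(h in X) galleries R (std_flag F n) h)%N.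
Proof.
rewrite -sum1_card (partition_big (@bs_proj F n R) (mem X)) /=; last first.
  by move=> Fs; rewrite !inE => /andP[].
apply: eq_bigr => h hX; rewrite -card_is_gallery ?coord_is_flag // -sum1_card.
apply: eq_bigl => Fs; rewrite !inE -/(is_gallery (std_flag F n) Fs).
by rewrite -andbA; congr (_ && _); apply: andb_idl => /eqP ->.
Qed.

End GallerySets.

(** * Cardinality of Schubert cells *)

Section SchubertCells.

Variables (F : finFieldType) (n : nat).
Implicit Types (v : 'S_n) (g : 'M[F]_n).

Lemma borelE g :
  (g \in borel F n) = (g \in unitmx) && (flag_act g (std_flag F n) == std_flag F n).
Proof.
rewrite inE; apply: andb_id2l => ug.
apply/'forall_forallP/(flag_act_coordP _ _ ug) => [g0 j k lt_jk|g0 j k].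
  by rewrite !perm1; apply/eqP/(implyP (g0 k j)).
by apply/implyP => lt_kj; have := g0 k j lt_kj; rewrite !perm1 => ->.
Qed.

Definition cell_stab v : {set 'M[F]_n} :=
  [set g in borel F n | flag_act g (coord_flag F v) == coord_flag F v].

Lemma borel_cell_stab : borel F n = cell_stab 1%g.
Proof. by apply/setP => g; rewrite [in RHS]inE borelE -andbA andbb. Qed.

(** Orbit and stabiliser: the fibre of the orbit map over the image of [g0] is the translate of the
    stabiliser by [g0]. *)
Lemma card_schubert_cell v :
  #|borel F n| = (#|schubert_cell F v| * #|cell_stab v|)%N.
Proof.
rewrite -sum1_card (partition_big (fun g => flag_act g (coord_flag F v))
  (mem (schubert_cell F v))) /=; last by move=> g; apply: imset_f.
rewrite -sum_nat_const; apply: eq_bigr => _ /imsetP[g0 + ->].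
rewrite borelE => /andP[ug0 /eqP g0E]; rewrite -sum1_card.
rewrite (reindex (mulmx g0)) /=; last first.
  by exists (mulmx (invmx g0)) => g _; rewrite (mulKmx, mulKVmx).
apply: eq_bigl => g; rewrite [in RHS]inE; congr (_ && _).
  by rewrite !borelE unitmx_mul ug0 flag_actM -{2}g0E (inj_eq (can_inj (flag_actK ug0))).
by rewrite flag_actM (inj_eq (can_inj (flag_actK ug0))).
Qed.

Lemma borel_unit g : (forall j k : 'I_n, (j < k)%N -> g k j = 0) ->
  (g \in unitmx) = [forall j, g j j != 0].
Proof.
move=> g0; rewrite -unitmx_tr unitmxE unitfE det_trig; last first.
  by apply/is_trig_mxP => j k lt_jk; rewrite mxE g0.
apply/prodf_neq0/forallP => [nz j|nz j _]; first by have := nz j isT; rewrite mxE.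
by rewrite mxE.
Qed.

(** Pairs of values of [v], so that they index matrix entries: these are the free off-diagonal
    entries of the stabiliser. For [v = 1] they are all entries above the diagonal. *)
Definition noninversions v : pred ('I_n * 'I_n) :=
  fun p => (p.1 < p.2)%N && (v^-1%g p.1 < v^-1%g p.2)%N.

Lemma cell_stabP v g :
  reflect (forall p : 'I_n * 'I_n, if p.1 == p.2 then g p.1 p.2 != 0
             else noninversions v p || (g p.1 p.2 == 0))
          (g \in cell_stab v).
Proof.
rewrite inE borelE -andbA; apply: (iffP and3P) => [[ug]|gP].
  move=> /(flag_act_coordP _ _ ug) g0 /(flag_act_coordP _ _ ug) gv [j k] /=.
  have {}g0 (l m : 'I_n) : (l < m)%N -> g m l = 0 by move/g0; rewrite !perm1.
  move: ug; rewrite borel_unit // => /forallP nz; case: eqP => [<- //|/eqP njk].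
  rewrite /noninversions /=; case: ltnP => [lt_jk|]; last first.
    by rewrite leq_eqVlt val_eqE eq_sym (negPf njk) => /g0 ->; rewrite eqxx.
  case: ltnP => //=; rewrite leq_eqVlt val_eqE (inj_eq perm_inj) eq_sym (negPf njk).
  by move/gv; rewrite !permKV => ->.
have g0 (j k : 'I_n) : (j < k)%N -> g k j = 0.
  move=> lt_jk; have := gP (k, j); rewrite /noninversions /= -val_eqE /=.
  by rewrite gtn_eqF // ltnNge (ltnW lt_jk) => /eqP.
have ug : g \in unitmx.
  by rewrite borel_unit //; apply/forallP => j; have := gP (j, j); rewrite eqxx.
split=> //; apply/(flag_act_coordP _ _ ug) => j k lt_jk.
  by rewrite !perm1 g0.
have := gP (v k, v j); rewrite /noninversions /= !permK (inj_eq perm_inj) -val_eqE.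
by rewrite gtn_eqF // [(k < j)%N]ltnNge (ltnW lt_jk) andbF => /eqP.
Qed.

(** By [cell_stabP] membership is decided entry by entry: [q - 1] choices on the diagonal, [q] at a
    noninversion, one elsewhere. *)
Lemma card_cell_stab v :
  #|cell_stab v| = (#|F|.-1 ^ #|[pred p : 'I_n * 'I_n | p.1 == p.2]| *
                    #|F| ^ #|noninversions v|)%N.
Proof.
pose A (p : 'I_n * 'I_n) : pred F := if p.1 == p.2 then predC1 0
  else if noninversions v p then predT else pred1 0.
pose mat (f : {ffun 'I_n * 'I_n -> F}) : 'M[F]_n := \matrix_(j, k) f (j, k).
have mat_inj : injective mat.
  by move=> f1 f2 /matrixP e; apply/ffunP => -[j k]; have := e j k; rewrite !mxE.
have -> : cell_stab v = mat @: [set f in family A].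
  apply/setP => g; apply/cell_stabP/imsetP => [gP|[f + ->] p].
    exists [ffun p => g p.1 p.2]; last by apply/matrixP => j k; rewrite mxE ffunE.
    rewrite inE; apply/familyP => p; rewrite ffunE /A; have := gP p.
    by case: ifP => // _; case: ifP.
  rewrite inE => /familyP/(_ p); rewrite /A mxE; case: p => j k /=.
  by case: ifP => // _; case: ifP.
rewrite card_imset // cardsE card_family foldrE big_map big_enum /=.
rewrite (bigID (fun p : 'I_n * 'I_n => p.1 == p.2)) /=; congr (_ * _)%N.
  rewrite (eq_bigr (fun=> #|F|.-1)) ?prod_nat_const // => p e.
  by rewrite /A e cardC1.
rewrite -prod_nat_const [RHS]big_mkcond /= [LHS]big_mkcond; apply: eq_bigr => p _.
rewrite /A; case: ifP => [/negPf ->|].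
  by case: ifP; rewrite -topredE /= => ->; rewrite ?card1.
by move/negbFE => /eqP e; rewrite -topredE /= /noninversions e ltnn.
Qed.

(** The Borel group is the stabiliser for [v = 1], so the diagonal factors of both sides agree and
    cancel, being nonzero as [q > 1]. *)
Lemma card_schubert_cell_pow v :
  (#|schubert_cell F v| * #|F| ^ #|noninversions v| =
   #|F| ^ #|noninversions 1%g|)%N.
Proof.
have := card_schubert_cell v; rewrite borel_cell_stab !card_cell_stab.
have lt1F : (1 < #|F|)%N := card_finNzRing_gt1 F.
rewrite mulnCA => /eqP; rewrite eqn_mul2l expn_eq0.
have -> : (#|F|.-1 == 0)%N = false by lia.
by move/eqP.
Qed.

(** The Borel group fixes the standard flag, so all points of a cell are ends of equally many
    galleries. *)
Lemma bs_prob_galleries R v :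
  bs_prob F R v =
  (#|schubert_cell F v| * galleries R (std_flag F n) (coord_flag F v))%N%:R
  / (#|F|%:R + 1) ^+ size R.
Proof.
rewrite /bs_prob card_bott_samelson -sum_nat_const; congr (_%:R / _).
apply: eq_bigr => _ /imsetP[g + ->]; rewrite borelE => /andP[ug /eqP gE].
by rewrite -{1}gE galleries_act.
Qed.

End SchubertCells.

(** * Probabilities as rational functions of [q] *)

Definition bs_num n (R : seq nat) (v : 'S_n) : {poly rat} :=
  'X^(#|noninversions (1%g : 'S_n)|) * gallery_poly R v^-1%g.

(** The cell size is a quotient of two powers of [q]; keeping one in the numerator and one here
    avoids subtracting exponents. *)
Definition bs_den n (L : nat) (v : 'S_n) : {poly rat} :=
  'X^(#|noninversions v|) * ('X + 1) ^+ L.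

Lemma bs_prob_ratfun n R (v : 'S_n) : is_word n R ->
  is_bs_prob_ratfun R v
    (FracField.tofrac (bs_num R v) / FracField.tofrac (bs_den (size R) v)).
Proof.
move=> wR; exists (bs_num R v), (bs_den (size R) v); split=> // F.
have q_gt0 : (0 < #|F|)%N by apply/card_gt0P; exists 0.
have q0 : #|F|%:R != 0 :> rat by rewrite Num.Theory.pnatr_eq0 -lt0n.
have q1 : #|F|%:R + 1 != 0 :> rat by rewrite natr1 Num.Theory.pnatr_eq0.
have cell : #|schubert_cell F v|%:R =
    #|F|%:R ^+ #|noninversions (1%g : 'S_n)| / #|F|%:R ^+ #|noninversions v| :> rat.
  apply: (canRL (mulfK (expf_neq0 _ q0))).
  by rewrite -!natrX -natrM card_schubert_cell_pow.
rewrite /bs_num /bs_den !hornerM !horner_exp hornerD hornerX hornerC.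
split; first by rewrite mulf_neq0 // expf_neq0.
by rewrite bs_prob_galleries natrM galleries_gallery_poly // cell invfM; ring.
Qed.

Theorem theorem4p3 (n : nat) (R1 R2 : seq nat) (i : nat) (Q R : seq nat) :
  reduced n R1 -> reduced n R2 ->
  (1 <= i <= n - 2)%N ->
  is_word n Q -> (size Q <= 1)%N -> is_word n R ->
  R1 = Q ++ [:: i; i.+1; i] ++ R ->
  R2 = Q ++ [:: i.+1; i; i.+1] ++ R ->
  exists (w : 'S_n) (f1 f2 : {fraction {poly rat}}),
    [/\ is_bs_prob_ratfun R1 w f1, is_bs_prob_ratfun R2 w f2 & f1 <> f2].
Proof.
(* The inverse offsets the one in [bs_num], so that the polynomials are compared at the permutation
   of [i :: R]. *)
move=> red1 red2 i_in _ sQ _ e1 e2; pose w := (word_perm n (i :: R))^-1%g.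
have s12 : size R2 = size R1 by rewrite e1 e2 !size_cat.
exists w, (FracField.tofrac (bs_num R1 w) / FracField.tofrac (bs_den (size R1) w)).
exists (FracField.tofrac (bs_num R2 w) / FracField.tofrac (bs_den (size R2) w)).
split; [exact: bs_prob_ratfun (proj1 (andP red1))|
        exact: bs_prob_ratfun (proj1 (andP red2))|].
have den0 : FracField.tofrac (bs_den (size R1) w) != 0.
  rewrite tofrac_eq0 mulf_neq0 ?expf_neq0 ?polyX_eq0 //.
  by rewrite -[1]opprK -polyCN polyXsubC_eq0.
(* Words of equal length share their denominator; cancelling it and the common power of ['X] leaves
   the gallery polynomials. *)
rewrite s12 => /(mulIf (invr_neq0 den0))/eqP; rewrite tofrac_eq.
move/eqP/(mulfI (expf_neq0 _ (negbT (polyX_eq0 _))))/eqP.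
rewrite invgK e1 e2; apply/negP.
by apply: gallery_poly_braid_neq; rewrite -?e1 -?e2.
Qed.
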